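(* Let $(r_k)_{k\ge 1}$ be a sequence of positive integers with $r_k > k$ for all $k$ and $r_k = (1+o(1))k$ as $k\to\infty$. Then $f(k;r_k) = \left(\tfrac12 \pm o(1)\right)k^2$, i.e. $\lim_{k\to\infty} f(k;r_k)/k^2 = 1/2$.
   Context: For a positive integer $m$, $[m] = \{1,\dots,m\}$, and $S_k$ is the set of permutations of $[k]$. A word $\sigma\in[r]^n$ contains $\tau \in S_k$ as a pattern if there are indices $1\le i_1<\dots<i_k\le n$ such that for all $j,j'\in[k]$, $\sigma(i_j)<\sigma(i_{j'})$ if and only if $\tau(j)<\tau(j')$. The word $\sigma$ is a $k$-superpattern if it contains every $\tau\in S_k$ as a pattern. For $r\ge k$, $f(k;r)$ denotes the minimum $n$ such that there is a $\sigma\in[r]^n$ which is a $k$-superpattern. *)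

(* Defs.v *)
From mathcomp Require Import all_boot perm.
Set Implicit Arguments.
Unset Strict Implicit.
Unset Printing Implicit Defensive.

(* Alphabets and index sets are 0-based: [m] = {1, ..., m} is 'I_m.  Pattern
   containment only depends on the order, so the shift is harmless. *)

Definition word (r n : nat) := {ffun 'I_n -> 'I_r}.

Definition contains_pattern (k r n : nat) (sigma : word r n) (tau : 'S_k) : bool :=
  [exists i : {ffun 'I_k -> 'I_n},
    [forall j : 'I_k, forall j' : 'I_k, (j < j') ==> (i j < i j')] &&
    [forall j : 'I_k, forall j' : 'I_k,
       (sigma (i j) < sigma (i j')) == (tau j < tau j')]].

Definition superpattern (k r n : nat) (sigma : word r n) : bool :=
  [forall tau : 'S_k, contains_pattern sigma tau].

(* Witness: k consecutive copies of the increasing word 0, 1, ..., r - 1. *)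
Lemma superpattern_exists (k r : nat) (kr : k <= r) :
  exists n, [exists sigma : word r n, superpattern k sigma].
Proof.
case: (posnP k) kr => [->|k0] kr.
  exists 0; apply/existsP.
  have e (i : 'I_0) : 'I_r by case: i.
  exists [ffun i => e i]; apply/forallP => tau; apply/existsP.
  exists [ffun i => i].
  by apply/andP; split; apply/forallP => -[].
have r0 : 0 < r by apply: leq_trans kr.
have modr m : m %% r < r by rewrite ltn_mod.
exists (k * r); apply/existsP; exists [ffun m : 'I_(k * r) => Ordinal (modr m)].
apply/forallP => tau; apply/existsP.
have tr (j : 'I_k) : tau j < r by apply: leq_trans kr.
have ub (j : 'I_k) : j * r + tau j < k * r.
  apply: (@leq_trans (j.+1 * r)); last by rewrite leq_mul2r ltn_ord orbT.
  by rewrite mulSn addnC ltn_add2r.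
exists [ffun j : 'I_k => Ordinal (ub j)].
apply/andP; split; apply/forallP => j; apply/forallP => j'.
  apply/implyP => jj'; rewrite !ffunE /=.
  apply: (@leq_trans (j.+1 * r)); first by rewrite mulSn addnC ltn_add2r.
  by apply: leq_trans (leq_addr _ _); rewrite leq_mul2r jj' orbT.
by rewrite !ffunE /= !modnMDl !modn_small.
Qed.

(* f(k; r); the value 0 for r < k, where no superpattern exists, is junk. *)
Definition min_superpattern (k r : nat) : nat :=
  if @idP (k <= r) is ReflectT kr then ex_minn (superpattern_exists kr) else 0.

Lemma min_superpatternP (k r : nat) (kr : k <= r) :
  (exists sigma : word r (min_superpattern k r), superpattern k sigma) /\
  (forall n (sigma : word r n), superpattern k sigma -> min_superpattern k r <= n).
Proof.
rewrite /min_superpattern; case: {-}_ / (@idP (k <= r)) => // kr'.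
case: ex_minnP => m /existsP[sigma ms] mmin; split; first by exists sigma.
by move=> n s ss; apply: mmin; apply/existsP; exists s.
Qed.

(* Main.v *)
(* Upper bound: concatenate k runs, alternately the even letters in increasing
   order and the odd letters in decreasing order.  Embedding a permutation or
   the same permutation with every letter raised by 1 greedily takes 2k + 1 runs
   in total, so one of the two fits into k runs of k/2 + 1 letters each.

   Lower bound: cut the positions of a pattern into m blocks of d letters.  In a
   word of length n one of the blocks is embedded in a window of length n/m.
   With e^(- l / r) as weight per letter, a window of length (1/2 - e) r d has at
   most r^d e^(- e^2 d / 4) subsequences of length d, while a random pattern
   induces on a given block a uniform injective word, of which there are about
   r^d when d/r is small.  Summing over the letter sets (e^o(k) of them), the
   blocks and the windows does not compensate this exponential loss. *)
Require Import Defs.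
From mathcomp Require Import all_boot all_order all_algebra.
From mathcomp Require Import all_classical all_reals all_analysis.
From mathcomp Require Import perm zify ring lra.
Set Implicit Arguments.
Unset Strict Implicit.
Unset Printing Implicit Defensive.
Import Order.TTheory GRing.Theory Num.Theory.
Import numFieldNormedType.Exports.

(** * Upper bound: greedy embedding into the zigzag word *)

(* Letter at position [q] of the concatenation of runs of [h] letters; [offset]
   is the place of a letter in its run, [jump] the number of run boundaries
   crossed by a greedy embedding between two consecutive letters, and [run] the
   index of the run reached. *)
Definition zigzag (h q : nat) : nat :=
  if odd (q %/ h) then (h.-1 - q %% h).*2.+1 else (q %% h).*2.

Definition offset (h a : nat) : nat := if odd a then h.-1 - a./2 else a./2.

Definition jump (a b : nat) : nat :=
  if odd a != odd b then 1 else if odd a (+) (a < b) then 0 else 2.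

Fixpoint run (x : nat -> nat) (c : nat) : nat :=
  if c is c'.+1 then run x c' + jump (x c') (x c) else odd (x 0).

Lemma offset_lt (h a : nat) : a < h.*2 -> offset h a < h.
Proof. by rewrite /offset; case: (odd a) => /= ah; lia. Qed.

(** Jumps are odd exactly at changes of parity, so the greedy embedding always reaches a run whose
    letters have the parity of the next letter. *)
Lemma odd_run (x : nat -> nat) (c : nat) : odd (run x c) = odd (x c).
Proof.
elim: c => [|c IH] /=; first by rewrite oddb.
rewrite oddD IH /jump.
by case: (odd (x c)); case: (odd (x c.+1)) => //=; case: ifP.
Qed.

Lemma zigzag_run (h : nat) (x : nat -> nat) (c : nat) : x c < h.*2 ->
  zigzag h (run x c * h + offset h (x c)) = x c.
Proof.
move=> xh; have oh := offset_lt xh.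
have h0 : 0 < h by apply: leq_ltn_trans oh.
rewrite /zigzag divnMDl // modnMDl divn_small // modn_small // addn0 odd_run.
rewrite /offset; have := odd_double_half (x c).
by case: (odd (x c)) => /=; lia.
Qed.

(** Two distinct letters share a run only if they have equal parity and come in the order of that
    run, and then the offset grows; otherwise a later run is entered. *)
Lemma run_offset_lt (h : nat) (x : nat -> nat) (c : nat) :
  x c < h.*2 -> x c.+1 < h.*2 -> x c != x c.+1 ->
  run x c * h + offset h (x c) < run x c.+1 * h + offset h (x c.+1).
Proof.
move=> ah bh ab; rewrite /= mulnDl -addnA ltn_add2l.
have := offset_lt ah; have := offset_lt bh.
move: (x c) (x c.+1) ah bh ab => a b ah bh ab.
rewrite /jump /offset.
have := odd_double_half a; have := odd_double_half b.
case: (odd a); case: (odd b) => /=; case: (ltnP a b) => /=; lia.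
Qed.

(* Adding 1 to every letter swaps the two parities, hence turns a jump by 0
   runs into a jump by 2 runs and conversely. *)
Lemma run_shift (x : nat -> nat) (c : nat) :
  run x c + run (S \o x) c = c.*2.+1.
Proof.
elim: c => [|c IH] /=; first by case: (odd _).
rewrite addnACA IH /jump /= ltnS.
by case: (odd (x c)); case: (odd (x c.+1)); case: (x c < x c.+1) => /=; lia.
Qed.

Lemma min_superpattern_le (k r : nat) : 0 < k -> k < r ->
  min_superpattern k r <= k * k./2.+1.
Proof.
move=> k0; case: r => [//|r]; rewrite ltnS => kr.
have [_ /(_ (k * k./2.+1))] := min_superpatternP (leqW kr); set h := k./2.+1.
have kh : k < h.*2 by rewrite /h; lia.
(* For even [k] the odd runs also contain [k + 1], which may lie outside the alphabet; [inord] then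
   gives 0. This is harmless, as only letters up to [k] are embedded. *)
pose w : word r.+1 (k * h) := [ffun q : 'I_(k * h) => inord (zigzag h q)].
move=> /(_ w) -> //; apply/forallP => tau.
pose x c : nat := tau (insubd (Ordinal k0) c).
(* By [run_shift] the last run indices for the letters [x] and [x + 1] sum to [2k - 1], so one of
   them is below [k]. *)
have [s [sb sr]] : exists s, s <= 1 /\ run (addn s \o x) k.-1 < k.
  have := run_shift x k.-1.
  case: (ltnP (run x k.-1) k) => e1 e2; [by exists 0 | exists 1; split=> //].
  by rewrite -[run _ _]/(run (S \o x) k.-1); lia.
pose y := addn s \o x.
have yk c : y c <= k.
  by rewrite /y /= /x; have := ltn_ord (tau (insubd (Ordinal k0) c)); lia.
have yh c : y c < h.*2 by apply: leq_ltn_trans kh.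
pose pos c := run y c * h + offset h (y c).
have posS : {in gtn k &, {homo pos : i j / i < j}}.
  apply: (@homo_ltn_in _ _ _ (fun i j => is_true (i < j))).
  - by move=> a b c; apply: ltn_trans.
  - by move=> i j; rewrite !inE => _ jk a /andP[_ /ltn_trans]; apply.
  move=> i; rewrite !inE => ik ik1; apply: run_offset_lt => //.
  rewrite /y /= eqn_add2l /x; apply/eqP => /val_inj/perm_inj/(congr1 val).
  by rewrite !val_insubd ik ik1; lia.
have pos_lt c : c < k -> pos c < k * h.
  move=> ck; apply: (@leq_ltn_trans (pos k.-1)).
    have : c <= k.-1 by lia.
    rewrite leq_eqVlt => /orP[/eqP->//|ck']; apply/ltnW/posS => //; rewrite inE; lia.
  apply: (@leq_trans ((run y k.-1).+1 * h)); last by rewrite leq_mul2r sr orbT.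
  by rewrite mulSn addnC /pos ltn_add2l offset_lt.
have wE (j : 'I_k) : w (Ordinal (pos_lt j (ltn_ord j))) = s + tau j :> nat.
  rewrite ffunE /= /pos zigzag_run // inordK ?(leq_ltn_trans (yk _)) //.
  by rewrite /y /= /x; congr (s + tau _); apply/val_inj; rewrite val_insubd ltn_ord.
pose i := [ffun j : 'I_k => Ordinal (pos_lt j (ltn_ord j))].
have iE j : i j = Ordinal (pos_lt j (ltn_ord j)) by rewrite ffunE.
apply/existsP; exists i; apply/andP; split; apply/forallP => j; apply/forallP => j'.
  by rewrite !iE; apply/implyP => jj' /=; apply: posS => //; rewrite inE.
by rewrite !iE !wE ltn_add2l.
Qed.

(** * Lower bound: counting permutations through short blocks *)

Lemma card_bigcup_le (I T : finType) (P : pred I) (F : I -> {set T}) :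
  #|\bigcup_(i | P i) F i| <= \sum_(i | P i) #|F i|.
Proof.
elim/big_rec2: _ => [|i m A _ le]; first by rewrite cards0.
by apply: leq_trans (leq_card_setU _ _) _; rewrite leq_add2l.
Qed.

(** Multiplying by the inverse of one member of [P] makes all of them fix [D] pointwise, hence move
    only points of the complement. *)
Lemma card_perm_agree_le (T : finType) (D : {set T}) (P : {set {perm T}}) :
  {in P &, forall s s' : {perm T}, {in D, s =1 s'}} -> #|P| <= (#|T| - #|D|)`!.
Proof.
move=> PD; have [->|[s0 s0P]] := finset.set_0Vmem P; first by rewrite cards0.
have -> : #|T| - #|D| = #|~: D| by rewrite (cardsCs (~: D)) finset.setCK.
rewrite -card_perm -(card_imset _ (mulIg s0^-1%g)).
apply/subset_leq_card/fintype.subsetP => _ /finset.imsetP[s sP ->].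
rewrite unfold_in; apply/fintype.subsetP => x; rewrite !inE permM.
apply: contra => xD.
by rewrite (PD _ _ sP s0P x xD) permK.
Qed.

Lemma subseq_iota (s : seq nat) (p L : nat) :
  sorted ltn s -> all (fun i => p <= i < p + L) s -> subseq s (iota p L).
Proof.
move=> s_sorted /allP s_iota.
suff -> : s = [seq i <- iota p L | i \in s] by apply: filter_subseq.
apply: (irr_sorted_eq ltn_trans ltnn) => //.
  exact/sorted_filter/iota_ltn_sorted/ltn_trans.
move=> i; rewrite mem_filter mem_iota.
by case: (boolP (i \in s)) => //= /s_iota ->.
Qed.

(* Otherwise each of the [m] blocks of [d] consecutive values spreads over more
   than [L] integers. *)
Lemma short_block (I : nat -> nat) (n m d L : nat) : 0 < d ->
    {in gtn (m * d) &, {homo I : a b / a < b}} ->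
    (forall a, a < m * d -> I a < n) -> n < m * L.+1 ->
  exists2 j, j < m & I (j * d + d.-1) < I (j * d) + L.
Proof.
move=> d0 I_mono I_lt nmL.
have [/hasP[j]|/hasPn no] :=
    boolP (has (fun j => I (j * d + d.-1) < I (j * d) + L) (iota 0 m)).
  by rewrite mem_iota; exists j.
have blk j a : j < m -> a < d -> j * d + a < m * d.
  move=> jm ad; apply: (@leq_trans (j.+1 * d)); last by rewrite leq_mul2r jm orbT.
  by rewrite mulSn addnC ltn_add2r.
have long j : j < m -> I (j * d) + L <= I (j * d + d.-1).
  by move=> jm; rewrite leqNgt no // mem_iota.
have dd : d.-1 < d by rewrite ltn_predL.
have grow j : j < m -> j * L.+1 + L <= I (j * d + d.-1).
  elim: j => [|j IH] jm; first by apply: leq_trans (long _ jm); rewrite leq_add2r.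
  apply: leq_trans (long _ jm); rewrite leq_add2r mulSn addSn addnC.
  apply: leq_ltn_trans (IH (ltnW jm)) _; apply: I_mono.
  - by rewrite inE blk // ltnW.
  - by rewrite inE -[_ * d]addn0 blk.
  by rewrite mulSn addnC ltn_add2r.
have m0 : 0 < m by case: (m) nmL.
have mm : m.-1 < m by rewrite ltn_predL.
have := leq_ltn_trans (grow _ mm) (I_lt _ (blk _ _ mm dd)).
by rewrite -ltnS -addnS addnC -mulSn prednK // ltnS leqNgt nmL.
Qed.

(** Encode a permutation by the letter set [v] of an occurrence, a block [j] that fits in a short
    window, the start [p] of the window and the word [y] on the block. At most [(k - d)!]
    permutations share a code, and this factor cancels against [k!]. *)
Lemma superpattern_ffact_le (k r n m d L N : nat) (sigma : word r n) :
    superpattern k sigma -> 0 < d -> m * d <= k -> n < m * L.+1 ->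
    (forall w : seq 'I_r, size w = L ->
       #|[set y : d.-tuple 'I_r | subseq y w]| <= N) ->
  k ^_ d <= 'C(r, k) * (m * (n * N)).
Proof.
move=> sup d0 mdk nmL cardN.
have m0 : 0 < m by case: (m) nmL.
have dk : d <= k by apply: leq_trans mdk; rewrite leq_pmull.
have k0 : 0 < k by apply: leq_trans dk.
case: n sigma sup nmL => [|n] sigma /forallP sup nmL.
  by have /existsP[i _] := sup 1%g; case: (i (Ordinal k0)).
rewrite -(leq_pmul2r (fact_gt0 (k - d))) ffact_fact // -!mulnA.
(* A window may overrun the word; positions past the end read the letter at position 0. All windows
   thus have length exactly [L], and subsequences are only added. *)
pose f a : 'I_r := sigma (inord a).
pose V := [set v : k.-tuple 'I_r | sorted ltn [seq val i | i <- v]].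
have ek (j : 'I_m) (t : 'I_d) : j * d + t < k.
  apply: leq_trans mdk; apply: (@leq_trans (j.+1 * d)); last first.
    by rewrite leq_mul2r ltn_ord orbT.
  by rewrite mulSn addnC ltn_add2r.
pose e j t := Ordinal (ek j t).
pose S p := [set y : d.-tuple 'I_r | subseq y [seq f a | a <- iota p L]].
pose T (v : k.-tuple 'I_r) (j : 'I_m) (y : d.-tuple 'I_r) := [set tau : 'S_k |
  [forall t, tnth v (tau (e j t)) == tnth y t]].
have cover : [set: 'S_k] \subset
    \bigcup_(v in V) \bigcup_j \bigcup_(p : 'I_n.+1) \bigcup_(y in S p) T v j y.
  apply/fintype.subsetP => tau _; have /existsP[i /andP[i_mono i_ord]] := sup tau.
  have {}i_mono (a b : 'I_k) : a < b -> i a < i b.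
    by move=> ab; have /forallP/(_ b)/implyP := forallP i_mono a; apply.
  have {}i_ord (a b : 'I_k) : (sigma (i a) < sigma (i b)) = (tau a < tau b).
    by have /forallP/(_ b)/eqP := forallP i_ord a.
  pose I a : nat := i (insubd (Ordinal k0) a).
  have IE (a : 'I_k) : I a = i a by rewrite /I valKd.
  have [||j jm Ij] := @short_block I n.+1 m d L d0 _ _ nmL.
  - move=> a b; rewrite !inE => am bm ab; apply: i_mono.
    by rewrite !val_insubd !(leq_trans _ mdk).
  - by move=> a _; apply: ltn_ord.
  pose jo := Ordinal jm; pose t0 := Ordinal d0.
  have dd : d.-1 < d by rewrite ltn_predL.
  have i0E : I (j * d) = i (e jo t0) by rewrite -IE /= addn0.
  have i1E : I (j * d + d.-1) = i (e jo (Ordinal dd)) by rewrite -IE.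
  (* [v] lists the letters of the occurrence in increasing order, so its entry at [tau a] is the
     letter matched to position [a]. *)
  pose v := [tuple sigma (i ((tau^-1)%g t)) | t < k].
  pose y := [tuple sigma (i (e jo t)) | t < d].
  have sorted_ord q : sorted (fun a b : 'I_q => a < b) (enum 'I_q).
    by have := iota_ltn_sorted 0 q; rewrite -val_enum_ord sorted_map.
  apply/finset.bigcupP; exists v.
    rewrite inE -map_comp; apply: homo_sorted (sorted_ord k) => a b ab /=.
    by rewrite i_ord !permKV.
  apply/finset.bigcupP; exists jo => //.
  apply/finset.bigcupP; exists (i (e jo t0)) => //.
  apply/finset.bigcupP; exists y; last first.
    by rewrite inE; apply/forallP => t; rewrite !tnth_mktuple permK.
  rewrite inE.
  have -> : val y = [seq f a | a <- [seq val (i (e jo t)) | t <- enum 'I_d]].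
    by rewrite /= -map_comp; apply: eq_map => t /=; rewrite /f inord_val.
  apply/map_subseq/subseq_iota.
    apply: homo_sorted (sorted_ord d) => a b ab /=.
    by apply: i_mono; rewrite /= ltn_add2l.
  have i_le (a b : 'I_k) : a <= b -> i a <= i b.
    by rewrite leq_eqVlt => /orP[/eqP/val_inj->//|/i_mono/ltnW].
  apply/allP => _ /mapP[t _ ->]; rewrite -i0E; apply/andP; split.
    by rewrite i0E; apply: i_le; rewrite /= leq_add2l.
  apply: leq_ltn_trans Ij; rewrite i1E; apply: i_le.
  by rewrite /= leq_add2l -ltnS prednK.
(* The letters of [v] are distinct, so [v] and [y] determine [tau] on the [d] positions of block
   [j]. *)
have cardT v j y : v \in V -> #|T v j y| <= (k - d)`!.
  rewrite inE => /(sorted_uniq ltn_trans ltnn).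
  rewrite (map_inj_uniq val_inj) => /tuple_uniqP v_inj.
  have eI : injective (e j) by move=> t t' /(congr1 val)/addnI/val_inj.
  have := @card_perm_agree_le _ [set e j t | t : 'I_d] (T v j y).
  rewrite card_imset // !card_ord; apply => s s'; rewrite !inE.
  move=> /forallP sT /forallP sT' _ /finset.imsetP[t _ ->].
  by apply: v_inj; rewrite (eqP (sT t)) (eqP (sT' t)).
rewrite -[k in k`!]card_ord -[#|'I_k|]cardsT -card_perm.
have -> : #|perm_on [set: 'I_k]| = #|[set: 'S_k]|.
  by apply: eq_card => s; rewrite !inE; apply/fintype.subsetP => x; rewrite inE.
apply: leq_trans (subset_leq_card cover) _.
rewrite -card_ltn_sorted_tuples -/V -sum_nat_const.
apply: leq_trans (card_bigcup_le _ _) _; apply: leq_sum => v vV.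
apply: leq_trans (card_bigcup_le _ _) _.
rewrite -[X in _ <= X * _]card_ord -sum_nat_const; apply: leq_sum => j _.
apply: leq_trans (card_bigcup_le _ _) _.
rewrite -[X in _ <= X * _]card_ord -sum_nat_const; apply: leq_sum => p _.
apply: leq_trans (card_bigcup_le _ _) _.
apply: (@leq_trans (#|S p| * (k - d)`!)).
  by rewrite -sum_nat_const; apply: leq_sum => y _; apply: cardT.
by rewrite leq_mul2r cardN ?orbT // size_map size_iota.
Qed.

(** * Counting the subsequences of a word *)

Local Open Scope ring_scope.

(** Matching [a] at its first occurrence leaves the longest suffix for [y]. *)
Lemma subseq_cons_index (T : eqType) (a : T) (y w : seq T) :
  subseq (a :: y) w = (a \in w) && subseq y (drop (index a w).+1 w).
Proof.
elim: w => [|b w IH] //=; rewrite in_cons (eq_sym b a).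
by case: eqVneq => [->|ab]; rewrite ?drop0 //= IH.
Qed.

(** The exponents are distinct, and for [q <= 1] the sum is largest when they are as small as
    possible. [P] is arbitrary because the induction on [w] removes the head letter from it. *)
Lemma sum_index_le (F : realDomainType) (T : finType) (q : F) (w : seq T)
    (P : {set T}) : 0 <= q <= 1 ->
  \sum_(a in P | a \in w) q ^+ index a w <= \sum_(i < #|P|) q ^+ i.
Proof.
move=> /andP[q0 q1].
have S0 m : 0 <= \sum_(i < m) q ^+ i by apply: sumr_ge0 => i _; apply: exprn_ge0.
elim: w P => [|b w IH] P; first by rewrite big1 // => a; rewrite in_nil andbF.
have tail (Q : {set T}) : b \notin Q ->
    \sum_(a in Q | a \in b :: w) q ^+ index a (b :: w) =
    q * \sum_(a in Q | a \in w) q ^+ index a w.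
  move=> bQ; rewrite mulr_sumr; apply: eq_big => a; rewrite in_cons.
    by case: eqVneq => [->|]; rewrite ?(negPf bQ).
  move=> /andP[aQ _] /=; rewrite -exprS ifN //.
  by apply: contraNneq bQ => ->.
have [bP|bP] := boolP (b \in P); last first.
  rewrite tail //; apply: le_trans (IH P).
  by rewrite ler_piMl // sumr_ge0 // => a _; apply: exprn_ge0.
rewrite (bigD1 b) ?bP ?mem_head //= eqxx expr0.
rewrite (eq_bigl (fun a => (a \in P :\ b) && (a \in b :: w))); last first.
  by move=> a; rewrite in_setD1 andbC andbA.
rewrite tail ?setD11 // (cardsD1 b P) bP add1n big_ord_recl expr0 lerD2l.
under [leRHS]eq_bigr do rewrite exprS.
by rewrite -mulr_sumr ler_wpM2l.
Qed.

(* Weight a word by q to the length of its shortest embedding: the first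
   occurrences of distinct letters are at distinct positions. *)
Lemma card_subseq_le (F : realDomainType) (r d : nat) (q : F) (w : seq 'I_r) :
  0 <= q <= 1 ->
  #|[set y : d.-tuple 'I_r | subseq y w]|%:R * q ^+ size w <=
  (\sum_(i < r) q ^+ i.+1) ^+ d.
Proof.
move=> /[dup] q01 /andP[q0 q1].
set Q := \sum_(i < r) _.
have Q0 : 0 <= Q by apply: sumr_ge0 => i _; apply: exprn_ge0.
elim: d w => [|d IH] w.
  rewrite expr0 -[leRHS]mulr1; apply: ler_pM; rewrite ?exprn_ge0 ?exprn_ile1 //.
  by rewrite lern1 (leq_trans (max_card _)) // card_tuple.
have -> : #|[set y : d.+1.-tuple 'I_r | subseq y w]| =
    (\sum_(a | a \in w)
       #|[set y : d.-tuple 'I_r | subseq y (drop (index a w).+1 w)]|)%N.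
  rewrite -sum1_card.
  rewrite (reindex (fun p : 'I_r * d.-tuple 'I_r => [tuple of p.1 :: p.2])) /=.
    rewrite (eq_bigl (fun p : 'I_r * d.-tuple 'I_r => (p.1 \in w) &&
      (p.2 \in [set y : d.-tuple 'I_r | subseq y (drop (index p.1 w).+1 w)]))).
      by rewrite -(pair_big_dep (fun a => a \in w) (fun a y =>
        y \in [set y : d.-tuple 'I_r | subseq y (drop (index a w).+1 w)])
        (fun _ _ => 1%N)); apply: eq_bigr => a _; rewrite sum1_card.
    by move=> [a y]; rewrite !inE subseq_cons_index.
  exists (fun y : d.+1.-tuple 'I_r => (thead y, [tuple of behead y])).
    by move=> [a y] _; congr pair; apply: val_inj.
  by move=> y _; rewrite [RHS]tuple_eta; apply: val_inj.
rewrite natr_sum mulr_suml.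
apply: (@le_trans _ _
  (\sum_(a in [set: 'I_r] | a \in w) q ^+ (index a w) * (q * Q ^+ d))).
  rewrite [leRHS](eq_bigl (fun a => a \in w)); last first.
    by move=> a; rewrite finset.in_setT.
  apply: ler_sum => a aw; have ia : (index a w < size w)%N by rewrite index_mem.
  rewrite -{1}(subnKC ia) exprD mulrCA [leRHS]mulrA -exprSr.
  by apply: ler_wpM2l; rewrite ?exprn_ge0 // -size_drop IH.
rewrite -mulr_suml exprS mulrA ler_wpM2r ?exprn_ge0 //.
under [Q]eq_bigr do rewrite exprSr.
rewrite /Q -mulr_suml ler_wpM2r //.
by have := sum_index_le w [set: 'I_r] q01; rewrite cardsT card_ord.
Qed.

(** * Exponential estimates *)

(** [expR (- x)] is at most [1 / (1 + x)], and [1 + x] times the right-hand side is [1 + x ^+ 3]. *)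
Lemma expRN_le (R : realType) (x : R) : 0 <= x -> expR (- x) <= 1 - x + x ^+ 2.
Proof.
move=> x0; rewrite expRN; have x1 : 0 < 1 + x by lra.
apply: (@le_trans _ _ (1 + x)^-1).
  by rewrite lef_pV2 ?posrE ?expR_gt0 ?expR_ge1Dx.
by rewrite -div1r ler_pdivrMr //; have := exprn_ge0 3 x0; nra.
Qed.

Lemma sum_affine_le (R : realFieldType) (n : nat) (c mu : R) : 0 <= mu ->
  \sum_(i < n) (c - mu * i.+1%:R) <= n%:R * c - mu * n%:R ^+ 2 / 2.
Proof.
move=> mu0; elim: n => [|n IH].
  by rewrite big_ord0 mul0r expr0n mulr0 mul0r subr0.
rewrite big_ord_recr /=; apply: le_trans (lerD IH (lexx _)) _.
by rewrite -[n.+1]addn1 natrD; nra.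
Qed.

Lemma card_subseq_expR_le (R : realType) (r d : nat) (e : R) (w : seq 'I_r) :
  (0 < r)%N -> 0 < e -> (size w)%:R <= (1 / 2 - e) * (r%:R * d%:R) ->
  #|[set y : d.-tuple 'I_r | subseq y w]|%:R <=
  r%:R ^+ d * expR (- (e ^+ 2 / 4 * d%:R)) :> R.
Proof.
move=> r0 e0 w_small; have rR : 0 < r%:R :> R by rewrite ltr0n.
(* With [q = expR (- l / r)] the exponent per letter comes to [l ^+ 2 - l * e], which is minimal,
   namely [- e ^+ 2 / 4], at [l = e / 2]. *)
pose l := e / 2; pose mu := l / r%:R.
have l0 : 0 < l by rewrite /l; lra.
have mu0 : 0 < mu by rewrite divr_gt0.
have mur : mu * r%:R = l by rewrite mulfVK ?gt_eqF.
have q01 : 0 <= expR (- mu) <= 1 by rewrite expR_ge0 expR_le1; lra.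
have := card_subseq_le d w q01; set N := #|_|%:R; set Q := \sum_(i < r) _.
rewrite -expRM_natr mulNr (expRN (mu * _)) ler_pdivrMr ?expR_gt0 //.
move=> /le_trans; apply.
have Q_le : Q <= r%:R * expR (l ^+ 2 - l / 2).
  apply: (@le_trans _ _ (\sum_(i < r) ((1 + l ^+ 2) - mu * i.+1%:R))).
    apply: ler_sum => i _; rewrite -expRM_natr mulNr.
    have mi0 : 0 <= mu * i.+1%:R by rewrite mulr_ge0 // ltW.
    apply: le_trans (expRN_le mi0) _.
    have : mu * i.+1%:R <= l by rewrite -mur ler_pM2l // ler_nat.
    by nra.
  apply: le_trans (sum_affine_le _ _ (ltW mu0)) _.
  have -> : r%:R * (1 + l ^+ 2) - mu * r%:R ^+ 2 / 2 = r%:R * (1 + (l ^+ 2 - l / 2)).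
    by rewrite -mur; ring.
  by rewrite ler_pM2l // expR_ge1Dx.
have Q0 : 0 <= Q by apply: sumr_ge0 => i _; rewrite exprn_ge0 ?expR_ge0.
apply: (@le_trans _ _
  ((r%:R * expR (l ^+ 2 - l / 2)) ^+ d * expR (mu * (size w)%:R))).
  by rewrite ler_pM2r ?expR_gt0 // lerXn2r ?nnegrE ?(le_trans Q0).
rewrite exprMn -[leLHS]mulrA ler_pM2l ?exprn_gt0 // -expRM_natr -expRD ler_expR.
have : mu * (size w)%:R <= l * ((1 / 2 - e) * d%:R).
  rewrite -mur -mulrA; apply: ler_wpM2l; first exact: ltW.
  by apply: le_trans w_small _; rewrite mulrCA.
by rewrite /l; nra.
Qed.

(** For [s = r - k], a single term of the expansion of [(1 + x) ^+ r] bounds ['C(r, s) * x ^+ s] by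
    [expR (x * r)], and [1 / x <= expR (1 / x)]. A small [x], and then [r - k] small against
    [x * k], make the exponent a small multiple of [k]. *)
Lemma bin_expR_le (R : realType) (r k : nat) (x : R) : (k <= r)%N -> 0 < x ->
  'C(r, k)%:R <= expR (x * r%:R + (r - k)%:R / x).
Proof.
move=> kr x0; rewrite expRD -bin_sub //; set s := (r - k)%N.
have sr : (s < r.+1)%N by rewrite ltnS leq_subr.
have le1 : 'C(r, s)%:R * x ^+ s <= expR (x * r%:R).
  rewrite expRM_natr; apply: (@le_trans _ _ ((1 + x) ^+ r)).
    rewrite exprDn (bigD1 (Ordinal sr)) //= expr1n mul1r mulr_natl lerDl.
    by apply: sumr_ge0 => i _; rewrite expr1n mul1r mulrn_wge0 // exprn_ge0 // ltW.
  by rewrite lerXn2r ?nnegrE ?expR_ge1Dx ?expR_ge0 //; lra.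
have le2 : (x ^+ s)^-1 <= expR (s%:R / x).
  rewrite mulrC expRM_natr -exprVn lerXn2r ?nnegrE ?invr_ge0 ?expR_ge0 ?(ltW x0) //.
  by have := expR_ge1Dx x^-1; lra.
have xs0 : 0 < x ^+ s by rewrite exprn_gt0.
rewrite -(mulfK (lt0r_neq0 xs0) 'C(r, s)%:R).
by apply: ler_pM le1 le2; rewrite ?mulr_ge0 ?invr_ge0 // ltW.
Qed.

Lemma ffact_ge_exp (k d : nat) : ((k - d) ^ d <= k ^_ d)%N.
Proof.
elim: d k => [|d IH] [|k] //; first by rewrite sub0n exp0n.
rewrite subSS ffactSS expnS leq_mul ?IH //; lia.
Qed.

Lemma natrX_ffact_le (R : realType) (k r d m : nat) (e : R) :
    (0 < r)%N -> (0 < d)%N -> (0 < m)%N -> (m * d <= k <= r)%N -> 0 < e ->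
    (min_superpattern k r)%:R <= (1 / 2 - e) * (m%:R * (r%:R * d%:R)) ->
  (k - d)%:R ^+ d <= 'C(r, k)%:R * m%:R * (min_superpattern k r)%:R *
    (r%:R ^+ d * expR (- (e ^+ 2 / 4 * d%:R))) :> R.
Proof.
move=> r0 d0 m0 /andP[mdk kr] e0 f_small.
have [[sigma sup] _] := min_superpatternP kr.
move: sigma sup f_small; set n := min_superpattern k r => sigma sup f_small.
set B := r%:R ^+ d * _.
have mR : 0 < m%:R :> R by rewrite ltr0n.
have B0 : 0 <= B by rewrite mulr_ge0 ?exprn_ge0 ?expR_ge0.
have cardB (w : seq 'I_r) : size w = (n %/ m)%N ->
    (#|[set y : d.-tuple 'I_r | subseq y w]%SET| <= Num.truncn B)%N.
  move=> sw; rewrite truncn_ge_nat //; apply: card_subseq_expR_le => //.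
  rewrite sw -(ler_pM2l mR) -[leLHS]natrM.
  apply: (@le_trans _ _ n%:R); first by rewrite ler_nat mulnC leq_trunc_div.
  by apply: le_trans f_small _; rewrite mulrCA.
have nm : (n < m * (n %/ m).+1)%N by rewrite mulnC ltn_ceil.
have := superpattern_ffact_le sup d0 mdk nm cardB.
move=> /(leq_trans (ffact_ge_exp k d)); rewrite -(ler_nat R) natrX.
move=> /le_trans; apply.
have BN : (Num.truncn B)%:R <= B by rewrite truncn_le.
clearbody B; by rewrite !natrM !mulrA; apply: ler_wpM2l BN; rewrite ?mulr_ge0.
Qed.

(** * Lower bound: choice of the constants *)

Lemma min_superpattern_gt (R : realType) (e : R) : 0 < e <= 1 / 2 ->
  exists2 h : R, 0 < h & exists K : R, forall k r : nat,
    (k < r)%N -> K < k%:R -> r%:R <= (1 + h) * k%:R ->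
    (1 / 2 - e) * k%:R ^+ 2 < (min_superpattern k r)%:R.
Proof.
move=> /andP[e0 e1].
(* [c] is the exponential loss per letter of a block for the deficit [e / 2]; the other half of [e]
   pays for rounding [k] to a multiple of [m]. *)
have [c cE] : exists c : R, (e / 2) ^+ 2 / 4 = c by exists ((e / 2) ^+ 2 / 4).
have c0 : 0 < c by rewrite -cE; nra.
have c1 : c <= 1 / 64 by rewrite -cE; nra.
(* Blocks become short, [d <= c * k / 8], which keeps [k - d] close to [k]. *)
have [m mc] : exists m : nat, 8 < c * m%:R.
  exists (Num.truncn (8 / c)).+1.
  by rewrite mulrC -ltr_pdivrMr // truncnS_gt.
have m2 : 512 < m%:R :> R by nra.
have m0 : 0 < m%:R :> R by lra.
have m_gt0 : (0 < m)%N by rewrite -(ltr0n R).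
(* [a * k] is about [c * d / 2]. Below, [x] and [h] make each of the two terms of the exponent in
   [bin_expR_le] at most [a * k / 4], and [h <= c / 8] gives [r <= (k - d) * expR (c / 2)]. *)
have [a am] : exists a : R, a * (2 * m%:R) = c.
  by exists (c / (2 * m%:R)); rewrite mulfVK // gt_eqF // mulr_gt0.
have a0 : 0 < a by nra.
have [x xE] : exists x : R, x = a / 8 by exists (a / 8).
have x0 : 0 < x by rewrite xE; lra.
have [h [h0 hc hx]] : exists h : R, [/\ 0 < h, h <= c / 8 & h <= a * x / 4].
  exists (Num.min (c / 8) (a * x / 4)); rewrite lt_min !ge_min !lexx orbT; split => //.
  by rewrite !divr_gt0 ?mulr_gt0.
have [B BE] : exists B : R, B = m%:R * expR (c / 2) by exists (m%:R * expR (c / 2)).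
have B0 : 0 < B by rewrite BE mulr_gt0 ?expR_gt0.
(* The first bound on [k] absorbs the rounding; the second lets the cubic term of [expR (a * k / 2)]
   reach [B * k ^+ 2]. *)
exists h => //; exists (Num.max (m%:R / e) (48 * B / a ^+ 3)) => k r kr.
rewrite gt_max ltr_pdivrMr // => /andP[kme kB] rh.
rewrite ltNge; apply/negP => small.
have k_gt0 : 0 < k%:R :> R by clear - m0 kme e0; nra.
have krR : k%:R <= r%:R :> R by rewrite ler_nat ltnW.
have km : m%:R < k%:R :> R by clear - k_gt0 kme e0 e1; nra.
have [d [d0 mdk kmd]] : exists d, [/\ 0 < d, m * d <= k & k < m * d.+1]%N.
  exists (k %/ m)%N; rewrite divn_gt0 // mulnC leq_trunc_div mulnC ltn_ceil //.
  by rewrite -(ler_nat R) ltW.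
have mdkR : m%:R * d%:R <= k%:R :> R by rewrite -natrM ler_nat.
have kmdR : k%:R < m%:R * (d%:R + 1) :> R by rewrite natr1 -natrM ltr_nat.
have d0R : 0 < d%:R :> R by rewrite ltr0n.
have e20 : 0 < e / 2 by rewrite divr_gt0.
have := natrX_ffact_le (leq_ltn_trans (leq0n _) kr) d0 m_gt0 _ e20.
move=> /(_ k); rewrite mdk (ltnW kr) cE => /(_ isT).
have f0 : 0 <= (min_superpattern k r)%:R :> R by rewrite ler0n.
move: (min_superpattern k r)%:R small f0 => f small f0.
have krk : k%:R * (k%:R - m%:R) <= m%:R * (r%:R * d%:R) :> R.
  by rewrite mulrCA; apply: ler_pM => //; clear - k_gt0 km kmdR; lra.
have f_le : f <= (1 / 2 - e / 2) * (m%:R * (r%:R * d%:R)).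
  apply: (le_trans small).
  apply: (@le_trans _ _ ((1 / 2 - e / 2) * (k%:R * (k%:R - m%:R)))).
    have -> : (1 / 2 - e) * k%:R ^+ 2 = (1 / 2 - e / 2) * (k%:R * (k%:R - m%:R)) -
      k%:R * ((k%:R * e - m%:R) / 2 + e * m%:R / 2) by field.
    by rewrite gerBl mulr_ge0 ?(ltW k_gt0) //; clear - kme e0 m0; nra.
  by apply: ler_wpM2l krk; clear - e1; lra.
move=> /(_ f_le) {f_le krk}.
have dk : (d <= k)%N by apply: leq_trans mdk; rewrite leq_pmull.
have [u uE] : exists u : R, u = (k - d)%:R by exists (k - d)%:R.
rewrite -uE => main; rewrite natrB // in uE.
have dck : d%:R <= c / 8 * k%:R :> R.
  rewrite -(ler_pM2l m0); apply: (le_trans mdkR).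
  by clear - k_gt0 mc; nra.
have u_ge : (1 - c / 8) * k%:R <= u by rewrite uE; clear - dck; lra.
have u0 : 0 < u by apply: lt_le_trans u_ge; rewrite mulr_gt0 //; clear - c1; lra.
have ru : r%:R <= u * expR (c / 2).
  apply: (@le_trans _ _ (u * (1 + c / 2))); last by rewrite ler_pM2l // expR_ge1Dx.
  apply: (le_trans rh); apply: (@le_trans _ _ ((1 - c / 8) * k%:R * (1 + c / 2))).
    by rewrite mulrAC ler_pM2r //; clear - hc c0 c1; nra.
  by rewrite ler_pM2r //; clear - c0; lra.
have C_le : 'C(r, k)%:R <= expR (a * k%:R / 2).
  apply: le_trans (bin_expR_le (ltnW kr) x0) _; rewrite ler_expR.
  have r2 : r%:R <= 2 * k%:R :> R by clear - rh hc c1 k_gt0; nra.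
  have xr : x * r%:R <= a * k%:R / 4.
    have := ler_wpM2l (ltW x0) r2; rewrite xE; clear; lra.
  have : (r - k)%:R / x <= a * k%:R / 4.
    rewrite (ler_pdivrMr _ _ x0) (natrB _ (ltnW kr)).
    by have := ler_wpM2r (ltW k_gt0) hx; clear - rh; lra.
  by clear - xr; lra.
have fk : f <= k%:R ^+ 2 by apply: (le_trans small); clear - e0 k_gt0; nra.
have rd : r%:R ^+ d <= u ^+ d * expR (c / 2 * d%:R).
  by rewrite expRM_natr -exprMn lerXn2r ?nnegrE // mulr_ge0 ?expR_ge0 // ltW.
(* Replacing [r ^+ d] by [u ^+ d] costs half of the loss [c * d]; the other half has to beat the
   binomial and polynomial factors. *)
have one_le : 1 <= expR (a * k%:R / 2) * m%:R * k%:R ^+ 2 * expR (- (c / 2 * d%:R)).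
  have ud0 : 0 < u ^+ d by rewrite exprn_gt0.
  rewrite -(ler_pM2l ud0) mulr1; apply: (le_trans main).
  rewrite [leRHS]mulrCA; apply: ler_pM; rewrite ?mulr_ge0 ?exprn_ge0 ?expR_ge0 //.
    by apply: ler_pM fk; rewrite ?mulr_ge0 // ler_wpM2r.
  have -> : - (c / 2 * d%:R) = c / 2 * d%:R - c * d%:R by field.
  by rewrite expRD mulrA ler_wpM2r ?expR_ge0.
have : expR (a * k%:R / 2) <= B * k%:R ^+ 2.
  have cd : - (c / 2 * d%:R) <= c / 2 - a * k%:R by rewrite -am; clear - kmdR a0; nra.
  rewrite -(ler_pM2r (expR_gt0 (- (a * k%:R / 2)))) expRxMexpNx_1.
  apply: (le_trans one_le).
  have -> : B * k%:R ^+ 2 * expR (- (a * k%:R / 2)) =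
      expR (a * k%:R / 2) * m%:R * k%:R ^+ 2 * expR (c / 2 - a * k%:R).
    have -> : - (a * k%:R / 2) = a * k%:R / 2 - a * k%:R by field.
    by rewrite BE !expRD; ring.
  by rewrite ler_wpM2l ?ler_expR // !mulr_ge0 ?exprn_ge0 ?expR_ge0.
apply/negP; rewrite -ltNge.
have y0 : 0 <= a * k%:R / 2 by rewrite divr_ge0 // mulr_ge0 // ltW.
apply: lt_le_trans (expR_ge1Dxn 2 y0).
rewrite ltr_pdivrMr ?exprn_gt0 // in kB.
have k2 : 0 < k%:R ^+ 2 :> R by rewrite exprn_gt0.
have -> : (a * k%:R / 2) ^+ 3 / 3`!%:R = k%:R * a ^+ 3 / 48 * k%:R ^+ 2.
  by rewrite (_ : 3`! = 6%N) //; field.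
have {}kB : B <= k%:R * a ^+ 3 / 48 by clear - kB; lra.
by have := ler_wpM2r (ltW k2) kB; clear; lra.
Qed.

(** * Passage to the limit *)

Local Open Scope classical_set_scope.
Local Open Scope ring_scope.

Theorem corollary1p1 (R : realType) (r : nat -> nat)
  (r_gt : forall k : nat, (0 < k)%N -> (k < r k)%N)
  (r_asymp : (r k)%:R / k%:R @[k --> \oo] --> (1 : R)) :
  (min_superpattern k (r k))%:R / k%:R ^+ 2 @[k --> \oo] --> (1 / 2 : R).
Proof.
apply/cvgrPdist_le => e0 e0_gt0.
pose e := Num.min e0 (1 / 2).
have e_gt0 : 0 < e <= 1 / 2 by rewrite lt_min ge_min lexx orbT e0_gt0 divr_gt0.
have ee0 : e <= e0 by rewrite ge_min lexx.
have [h h_gt0 [K lower]] := min_superpattern_gt e_gt0.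
have /cvgrPdist_le/(_ h h_gt0) r_near := r_asymp.
near=> k.
have kK : K < k%:R :> R by near: k; apply: nbhs_infty_gtr.
(* This makes the linear term of the upper bound [k ^+ 2 / 2 + k] at most [e0 * k ^+ 2]. *)
have ke : e0^-1 < k%:R :> R by near: k; apply: nbhs_infty_gtr.
have k_gt0 : 0 < k%:R :> R by apply: lt_trans ke; rewrite invr_gt0.
have k_gt0N : (0 < k)%N by rewrite -(ltr0n R).
have rh : (r k)%:R <= (1 + h) * k%:R :> R.
  rewrite -ler_pdivrMr //.
  have : `|1 - (r k)%:R / k%:R| <= h by near: k.
  by rewrite ler_norml; lra.
have k2_gt0 : 0 < k%:R ^+ 2 :> R by rewrite exprn_gt0.
have low := lower k (r k) (r_gt k k_gt0N) kK rh.
have up : (min_superpattern k (r k))%:R <= k%:R ^+ 2 / 2 + k%:R :> R.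
  have f_le := min_superpattern_le k_gt0N (r_gt k k_gt0N).
  have : (min_superpattern k (r k) * 2 <= k * k + k * 2)%N.
    rewrite -mulnDr; apply: (@leq_trans (k * k./2.+1 * 2)%N).
      by rewrite leq_mul2r f_le.
    rewrite -mulnA leq_mul2l mulSn addnC leq_add2r muln2.
    by rewrite -[leqRHS]odd_double_half leq_addl orbT.
  by rewrite -(ler_nat R) natrD !natrM; lra.
rewrite ler_distlC; apply/andP; split.
  rewrite ler_pdivlMr //; nra.
rewrite ler_pdivrMr //.
have : 1 < e0 * k%:R by rewrite -ltr_pdivrMl // mulr1.
nra.
Unshelve. all: by end_near.
Qed.
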